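(* Let $(X,d)$ be a uniformly disconnected metric space, let $(Y,d')$ be a metric space, and let $f:(X,d)\to(Y,d')$ be a quasi-Möbius homeomorphism. Then $(Y,d')$ is uniformly disconnected.
   Context: For $\theta<1$, a \emph{$\theta$-chain} in a metric space $(X,d)$ is a finite sequence $(x_0,x_1,\ldots,x_n)$ of points of $X$, containing at least $3$ distinct points, such that $d(x_i,x_{i+1})\le\theta\, d(x_0,x_n)$ for all $i\in\{0,1,\ldots,n-1\}$. A metric space is \emph{uniformly disconnected} if there exists a constant $\theta$ with $0<\theta<1$ such that the space contains no $\theta$-chain. For a quadruple $Q=(x_1,x_2,x_3,x_4)$ of distinct points of a metric space $(X,d)$, the \emph{cross-ratio} is $$\mathrm{cr}(Q,d):=\frac{d(x_1,x_3)\,d(x_2,x_4)}{d(x_1,x_4)\,d(x_2,x_3)}.$$ A map $f:(X,d)\to(Y,d')$ is \emph{quasi-Möbius} if it is a homeomorphism and there exists a homeomorphism $\nu:[0,\infty)\to[0,\infty)$ such that for all quadruples $Q=(x_1,x_2,x_3,x_4)$ of distinct points of $X$, with $Q':=(f(x_1),f(x_2),f(x_3),f(x_4))$, one has $\mathrm{cr}(Q',d')\le\nu(\mathrm{cr}(Q,d))$. *)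

(* Defs.v *)
From mathcomp Require Import all_boot all_order all_algebra.
From mathcomp Require Import all_classical all_reals all_analysis.

Set Implicit Arguments.
Unset Strict Implicit.
Unset Printing Implicit Defensive.

Import Order.TTheory GRing.Theory Num.Theory.
Import numFieldNormedType.Exports.

Local Open Scope classical_set_scope.
Local Open Scope ring_scope.

(* The chain (x_0, x_1, ..., x_n) is given by its first point x0 = x_0 and the
   sequence s = [:: x_1; ...; x_n] of the remaining ones. *)
Definition theta_chain (R : realType) (X : metricType R) (theta : R)
    (x0 : X) (s : seq X) : Prop :=
  (3 <= size (undup (x0 :: s)))%N /\
  path (fun x y => mdist x y <= theta * mdist x0 (last x0 s)) x0 s.

Definition uniformly_disconnected (R : realType) (X : metricType R) : Prop :=
  exists theta : R, 0 < theta < 1 /\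
    forall (x0 : X) (s : seq X), ~ theta_chain theta x0 s.

Definition cross_ratio (R : realType) (X : metricType R)
    (x1 x2 x3 x4 : X) : R :=
  (mdist x1 x3 * mdist x2 x4) / (mdist x1 x4 * mdist x2 x3).

Definition homeomorphism (T U : topologicalType) (f : T -> U) : Prop :=
  exists g : U -> T, [/\ cancel f g, cancel g f, continuous f & continuous g].

(* f restricts to a homeomorphism of the subspace A onto itself; the values of
   f and g outside A are irrelevant. *)
Definition self_homeomorphism_on (T : topologicalType) (A : set T)
    (f : T -> T) : Prop :=
  [/\ set_bij A A f, {within A, continuous f} &
      exists2 g : T -> T, {in A, cancel f g} & {within A, continuous g}].

Definition quasi_mobius (R : realType) (X Y : metricType R)
    (f : X -> Y) : Prop :=
  homeomorphism f /\
  exists nu : R -> R, self_homeomorphism_on (`[0, +oo[ : set R) nu /\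
    forall x1 x2 x3 x4 : X, uniq [:: x1; x2; x3; x4] ->
      cross_ratio (f x1) (f x2) (f x3) (f x4) <= nu (cross_ratio x1 x2 x3 x4).

(* Main.v *)
(* Let f be quasi-Moebius and let y_0, ..., y_n be a theta-chain in Y with theta
   tiny. Cut out the stretch of the chain between the last exit from a small ball
   around y_0 and the next entry into a small ball around y_n. Along this stretch
   the cross-ratios of consecutive points with y_0 and y_n are small, whereas
   between its ends the ratio r = d(., y_0) / d(., y_n) grows by a large factor.
   Both facts only involve cross-ratios, so they pass to the preimages in X, where
   y_0 and y_n become p and q. Exchanging p and q if necessary, r starts far below
   1/2 there; the points preceding the first one at which r reaches the minimum of
   1/2 and its final value lie at distance comparable to d(p, q) from q, so p
   followed by the stretch up to that first point is a chain in X with small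
   steps. *)

Require Import Defs.
From mathcomp Require Import all_boot all_order all_algebra.
From mathcomp Require Import all_classical all_reals all_analysis.
From mathcomp Require Import ring lra.

Set Implicit Arguments.
Unset Strict Implicit.
Unset Printing Implicit Defensive.

Import Order.TTheory GRing.Theory Num.Theory.

Local Open Scope classical_set_scope.
Local Open Scope ring_scope.

(** * Cutting stretches out of finite sequences *)

(** Since [Q] fails at [a], the first hit [k] always has a predecessor, [last a t], at which [Q]
    still fails. *)
Lemma seq_first_hit (T : Type) (Q : pred T) (a : T) (s : seq T) :
    ~~ Q a -> Q (last a s) ->
  exists t k t', [/\ s = t ++ k :: t', all (predC Q) (a :: t) & Q k].
Proof.
move=> Qa Ql; have hs : has Q s.
  by case: s Ql => [|x s Ql]; [rewrite /= (negbTE Qa)|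
    apply/(has_nthP a); exists (size s); rewrite ?nth_last//= ltnS].
case: (split_find_nth a hs) => k t t' Qk Qt.
by exists t, k, t'; rewrite cat_rcons; split => //=; rewrite Qa all_predC.
Qed.

(** Points are dropped from the front as long as [P] recurs later. The last point [z] in [P] is kept
    because the step from [z] to [b] shows that [b] has barely left [P]. *)
Lemma path_last_exit (T : Type) (e : rel T) (P : pred T) (a : T) (s : seq T) :
    has P (a :: s) -> ~~ P (last a s) -> path e a s ->
  exists z b t, [/\ P z, e z b, path e b t, all (predC P) (b :: t) &
    last b t = last a s].
Proof.
elim: s a => [a /=|b s IH a hP /= Pl /andP[eab es]].
  by rewrite orbF => ->.
have [hbs|nbs] := boolP (has P (b :: s)); first exact: IH.
have Pa : P a by case/orP: hP => // hs; case/negP: nbs.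
by exists a, b, s; split => //; rewrite -all_predC in nbs.
Qed.

(** * Chains from sequences with small cross-ratios *)

(* The two cross-ratios of [x], [y], [p], [q] with numerator
   [mdist x y * mdist p q] are at most [eta]; clearing denominators makes sense of
   this for coinciding points. *)
Definition mobius_close (R : realType) (X : metricType R) (p q : X) (eta : R)
    (x y : X) : bool :=
  (mdist x y * mdist p q <= eta * (mdist x p * mdist y q)) &&
  (mdist x y * mdist p q <= eta * (mdist x q * mdist y p)).

Lemma mobius_closeC (R : realType) (X : metricType R) (p q : X) (eta : R) x y :
  mobius_close p q eta x y = mobius_close p q eta y x.
Proof.
by rewrite /mobius_close andbC (metric_sym x y) (mulrC (mdist x q))
  (mulrC (mdist x p)).
Qed.

Lemma mobius_close_swap (R : realType) (X : metricType R) (p q : X) (eta : R)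
  x y : mobius_close q p eta x y = mobius_close p q eta x y.
Proof. by rewrite /mobius_close andbC (metric_sym q p). Qed.

(* Where [mdist _ p / mdist _ q] stays below [1/2], distances to [q] are
   comparable with [mdist p q], so small cross-ratios bound plain distances. *)
Lemma theta_chain_of_mobius_close (R : realType) (X : metricType R)
    (eta : R) (p q a : X) (t : seq X) :
    0 < eta -> eta < 1 -> p != q -> a != p -> a != q ->
    last a t != p -> last a t != q ->
    path (mobius_close p q eta) a t ->
    mdist a p * mdist (last a t) q <= eta * (mdist (last a t) p * mdist a q) ->
    mdist a p <= eta / 2 * mdist a q ->
  exists s, theta_chain (12 * eta) p s.
Proof.
move=> e0 e1 pq ap aq; set b := last a t => bp bq et hab ha.
have D0 : 0 < mdist p q by rewrite mdist_gt0.
have va0 : 0 < mdist a q by rewrite mdist_gt0.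
have ua0 : 0 < mdist a p by rewrite mdist_gt0.
have vb0 : 0 < mdist b q by rewrite mdist_gt0.
have ub0 : 0 < mdist b p by rewrite mdist_gt0.
set D := mdist p q in D0.
(* The cap [1 / 2] keeps points below the threshold away from [q]; the other term guarantees that
   [b] reaches it. The two bounds on [a] in the hypotheses serve one value of the minimum each. *)
pose T := Num.min (mdist b p / mdist b q) (1 / 2).
have T0 : 0 < T by rewrite lt_min divr_gt0//= divr_gt0.
have T2 : T <= 1 / 2 by rewrite ge_min lexx orbT.
have Tb : T * mdist b q <= mdist b p.
  by rewrite -ler_pdivlMr// ge_min lexx.
have Ta : mdist a p <= eta * T * mdist a q.
  rewrite /T; case: (leP (_ / _) (1 / 2)) => _; last by rewrite div1r.
  have -> : eta * (mdist b p / mdist b q) * mdist a q =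
      eta * (mdist b p * mdist a q) / mdist b q by ring.
  by rewrite ler_pdivlMr.
pose Q x := T * mdist x q <= mdist x p.
have Qa : ~~ Q a.
  rewrite /Q -ltNge; apply: le_lt_trans Ta _.
  by rewrite ltr_pM2r// gtr_pMl.
have [t1 [k [t2 [tE Qt1 Qk]]]] := seq_first_hit Qa Tb.
move: et; rewrite tE cat_path => /and3P[et1 ek _].
have bnd x : ~~ Q x -> [/\ mdist x p <= 2 * (T * D), mdist x q <= 2 * D &
    2 * D <= 3 * mdist x q].
  rewrite /Q -ltNge => xT.
  have h1 : mdist x q <= mdist x p + D := metric_triangle _ _ _.
  have h2 : D <= mdist x p + mdist x q.
    by rewrite (metric_sym x p); exact: metric_triangle.
  have v0 : 0 <= mdist x q := mdist_ge0 _ _.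
  have h3 : T * mdist x q <= 1 / 2 * mdist x q by exact: ler_wpM2r.
  have h4 : mdist x q <= 2 * D by lra.
  have h5 : T * mdist x q <= T * (2 * D) by exact: ler_wpM2l (ltW T0) _ _ h4.
  by split; [lra|lra|lra].
have [la1 la2 la3] := bnd _ Qa.
have Ql : ~~ Q (last a t1) by have /allP/(_ _ (mem_last a t1)) := Qt1.
set l := last a t1 in ek Ql.
have [ll1 ll2 ll3] := bnd _ Ql.
have vk0 : 0 <= mdist k q := mdist_ge0 _ _.
(* [bnd] does not apply to [k], which has passed the threshold; its distance to [q] is bounded below
   through its predecessor [l]. *)
have vk : D <= 3 * mdist k q.
  have /andP[h _] := ek.
  have h1 : mdist l q <= mdist l k + mdist k q := metric_triangle _ _ _.
  have h2 : mdist l k <= mdist k q.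
    rewrite -(ler_pM2r D0); apply: le_trans h _.
    rewrite mulrA (mulrC _ D); apply: ler_wpM2r => //.
    have : eta * mdist l p <= mdist l p.
      by apply: ler_piMl; [exact: mdist_ge0|exact: ltW].
    have : T * D <= 1 / 2 * D by rewrite ler_pM2r.
    lra.
  lra.
have TDk : T * D <= 3 * mdist p k.
  have : T * D <= T * (3 * mdist k q) by rewrite ler_pM2l.
  by move: Qk; rewrite /Q (metric_sym k p); lra.
have TD0 : 0 < T * D by rewrite mulr_gt0.
have k0 : 0 < mdist p k by lra.
exists (a :: rcons t1 k); split.
  rewrite -[3%N]/(size [:: p; a; k]).
  apply: uniq_leq_size.
    rewrite /= !inE !andbT negb_or eq_sym ap/= -mdist_gt0 k0/=.
    by apply: contra Qa => /eqP ->.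
  move=> x; rewrite !inE mem_undup => /or3P[] /eqP ->; rewrite !inE ?eqxx//.
    by rewrite orbT.
  by rewrite mem_rcons inE eqxx !orbT.
(* With [T * D <= 3 * mdist p k], the first step is at most [6 * eta * mdist p k] and the inner
   ones, at most [4 * eta * (T * D)], give the constant 12. The last step uses the other
   cross-ratio, whose bound contains [mdist k p] itself. *)
rewrite /= last_rcons rcons_path; apply/and3P; split.
- rewrite (metric_sym p a).
  have : eta * T * mdist a q <= eta * T * (2 * D).
    by rewrite ler_pM2l// mulr_gt0.
  have : eta * (T * D) <= eta * (3 * mdist p k) by rewrite ler_pM2l.
  have : 0 < eta * mdist p k by rewrite mulr_gt0.
  lra.
- apply: sub_in_path Qt1 et1 => x y; rewrite !inE => Qx Qy /andP[h _].
  have [x1 x2 x3] := bnd _ Qx; have [y1 y2 y3] := bnd _ Qy.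
  rewrite -(ler_pM2r D0); apply: le_trans h _.
  have : mdist x p * mdist y q <= 2 * (T * D) * (2 * D).
    by apply: ler_pM => //; exact: mdist_ge0.
  rewrite -(ler_pM2l e0) => /le_trans; apply.
  have -> : eta * (2 * (T * D) * (2 * D)) = 4 * eta * (T * D) * D by ring.
  rewrite ler_pM2r//.
  have : eta * (T * D) <= eta * (3 * mdist p k) by rewrite ler_pM2l.
  lra.
- have /andP[_ h] := ek.
  rewrite -(ler_pM2r D0) (metric_sym p k); apply: le_trans h _.
  have : mdist l q * mdist k p <= 2 * D * mdist k p.
    by rewrite ler_wpM2r// mdist_ge0.
  rewrite -(ler_pM2l e0) => /le_trans; apply.
  have : 0 <= eta * (D * mdist k p) by rewrite !mulr_ge0 ?mdist_ge0// ltW.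
  lra.
Qed.

(** The factor [eta ^+ 2 / 4] is the square of [eta / 2]: either [mdist a p / mdist a q] or
    [mdist b q / mdist b p], with [b] the last point, is at most [eta / 2]. In the second case the
    sequence is reversed and [p], [q] are exchanged. *)
Lemma theta_chain_of_mobius_chain (R : realType) (X : metricType R)
    (eta : R) (p q a : X) (t : seq X) :
    0 < eta -> eta < 1 -> p != q -> a != p -> a != q ->
    last a t != p -> last a t != q ->
    path (mobius_close p q eta) a t ->
    mdist a p * mdist (last a t) q <=
      eta ^+ 2 / 4 * (mdist (last a t) p * mdist a q) ->
  exists p0 s, theta_chain (12 * eta) (p0 : X) s.
Proof.
move=> e0 e1 pq ap aq bp bq et hab.
set b := last a t in bp bq hab.
have e2 : eta ^+ 2 / 4 <= eta by nra.
have va0 : 0 < mdist a q by rewrite mdist_gt0.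
have ub0 : 0 < mdist b p by rewrite mdist_gt0.
have hab' : mdist a p * mdist b q <= eta * (mdist b p * mdist a q).
  by apply: le_trans hab _; rewrite ler_pM2r// mulr_gt0.
have [ha|ha] := leP (mdist a p) (eta / 2 * mdist a q).
  by exists p; exact: (theta_chain_of_mobius_close e0 e1 pq ap aq bp bq et).
have lr : last b (rev (belast a t)) = a.
  by rewrite /b; case: (t) => //= x s; rewrite rev_cons last_rcons.
exists q; apply: (@theta_chain_of_mobius_close _ _ eta q p b
  (rev (belast a t))) => //; rewrite ?lr //.
- by rewrite eq_sym.
- rewrite rev_path; apply: sub_path et => x y.
  by rewrite mobius_close_swap mobius_closeC.
- by rewrite mulrC (mulrC (mdist a q)).
- rewrite -(ler_pM2l va0) -(ler_pM2l e0).
  have : eta / 2 * mdist a q * mdist b q <= mdist a p * mdist b q.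
    by rewrite ler_wpM2r ?mdist_ge0// ltW.
  lra.
Qed.

(** * Transfer of small cross-ratios back through a quasi-Moebius map *)

(* Exchanging the first two points inverts the cross-ratio, so an upper bound
   for [nu] on [[0, 1/eta]] gives the lower bound needed here. *)
Lemma quasi_mobius_small (R : realType) (X Y : metricType R) (f : X -> Y) :
    quasi_mobius f -> forall eta : R, 0 < eta ->
  exists2 delta : R, 0 < delta &
    forall x1 x2 x3 x4 : X, uniq [:: x1; x2; x3; x4] ->
      mdist (f x1) (f x3) * mdist (f x2) (f x4) <=
        delta * (mdist (f x1) (f x4) * mdist (f x2) (f x3)) ->
      mdist x1 x3 * mdist x2 x4 <= eta * (mdist x1 x4 * mdist x2 x3).
Proof.
case=> [[g [fK _ _ _]] [nu [[_ cnu _] hnu]]] eta e0.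
have M0 : 0 <= eta^-1 by rewrite invr_ge0 ltW.
have sub : `[0, eta^-1] `<=` `[0, +oo[.
  move=> x /=; by rewrite !in_itv/= andbT => /andP[].
have [c _ hc] := EVT_max M0 (continuous_subspaceW sub cnu).
(* The summand 1 makes the bound on the inverted cross-ratio strict, which yields the
   contradiction. *)
exists (Num.max (nu c) 0 + 1)^-1.
  by rewrite invr_gt0 ltr_wpDl// le_max lexx orbT.
move=> x1 x2 x3 x4 u h; rewrite leNgt; apply/negP => hlt.
have u' : uniq [:: x2; x1; x3; x4].
  by move: u; rewrite /= !inE !negb_or (eq_sym x1 x2) => /and4P[/and3P[-> -> ->]
    /andP[-> ->] -> _].
have : [&& x1 != x3, x2 != x4, x1 != x4 & x2 != x3].
  by move: u; rewrite /= !inE !negb_or => /and4P[/and3P[_ -> ->]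
    /andP[-> ->] _ _].
move=> /and4P[n13 n24 n14 n23].
have fI := can_inj fK.
have p13 : 0 < mdist x1 x3 * mdist x2 x4 by rewrite mulr_gt0 ?mdist_gt0.
have p14 : 0 < mdist x1 x4 * mdist x2 x3 by rewrite mulr_gt0 ?mdist_gt0.
have q13 : 0 < mdist (f x1) (f x3) * mdist (f x2) (f x4).
  by rewrite mulr_gt0 ?mdist_gt0// inj_eq.
have q14 : 0 < mdist (f x1) (f x4) * mdist (f x2) (f x3).
  by rewrite mulr_gt0 ?mdist_gt0// inj_eq.
have crE (Z : metricType R) (z1 z2 z3 z4 : Z) : cross_ratio z2 z1 z3 z4 =
    mdist z1 z4 * mdist z2 z3 / (mdist z1 z3 * mdist z2 z4).
  by rewrite /cross_ratio mulrC (mulrC (mdist z2 z3)) (mulrC (mdist z2 z4)) mulrC.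
have crI : cross_ratio x2 x1 x3 x4 \in `[0, eta^-1].
  rewrite in_itv/= crE divr_ge0 ?(ltW p14) ?(ltW p13)//= ler_pdivrMr//.
  by rewrite ler_pdivlMl// ltW.
have := le_trans (hnu _ _ _ _ u') (hc _ crI).
rewrite crE ler_pdivrMr// => hle.
have B0 : 0 < Num.max (nu c) 0 + 1 by rewrite ltr_wpDl// le_max lexx orbT.
move: h; rewrite ler_pdivlMl// => h.
have : nu c * (mdist (f x1) (f x3) * mdist (f x2) (f x4)) <=
    Num.max (nu c) 0 * (mdist (f x1) (f x3) * mdist (f x2) (f x4)).
  by rewrite ler_pM2r// le_max lexx.
lra.
Qed.

(** * Chains in the target and the final contradiction *)

(** If the ends coincided, every step would have length zero and the chain would consist of a single
    point. *)
Lemma theta_chain_gt0 (R : realType) (X : metricType R) (theta : R) (x0 : X)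
    (s : seq X) :
  theta_chain theta x0 s -> 0 < mdist x0 (last x0 s).
Proof.
case=> hs hp; rewrite mdist_gt0; apply/eqP => l0.
move: hp; rewrite -l0 mdistxx mulr0 => hp.
have : path eq_op x0 s.
  apply: sub_path hp => x y; rewrite le_eqVlt ltNge mdist_ge0 orbF => /eqP h.
  by apply/eqP; exact: mdist_positivity.
move=> /(order_path_min (fun _ _ _ => _)) => /(_ _)/allP h.
suff : (size (undup (x0 :: s)) <= size [:: x0])%N by move/(leq_trans hs).
apply: uniq_leq_size; first exact: undup_uniq.
move=> x; rewrite mem_undup !inE => /orP[//|/h]; rewrite eq_sym; apply.
by move=> ? ? ? /eqP -> .
Qed.

Theorem theorem2 (R : realType) (X Y : metricType R) (f : X -> Y)
    (hX : uniformly_disconnected X) (hf : quasi_mobius f) :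
  uniformly_disconnected Y.
Proof.
have [theta [/andP[th0 th1] nochain]] := hX.
pose eta := theta / 12.
have e0 : 0 < eta by rewrite divr_gt0.
have e1 : eta < 1 by rewrite /eta; lra.
have e2 : eta ^+ 2 / 4 <= eta by nra.
have e3 : 0 < eta ^+ 2 / 4 by rewrite divr_gt0// exprn_gt0.
have [delta d0 hd] := quasi_mobius_small hf e3.
have [[g [fK gK _ _]] _] := hf.
have gI := can_inj gK.
have hg y1 y2 y3 y4 : uniq [:: y1; y2; y3; y4] ->
    mdist y1 y3 * mdist y2 y4 <= delta * (mdist y1 y4 * mdist y2 y3) ->
    mdist (g y1) (g y3) * mdist (g y2) (g y4) <=
      eta ^+ 2 / 4 * (mdist (g y1) (g y4) * mdist (g y2) (g y3)).
  move=> u h; apply: hd; last by rewrite !gK.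
  by rewrite -(map_inj_uniq gI) in u.
(* Steps of length at most [al ^+ 3 * L] between points outside balls of radius [al * L] have
   cross-ratios at most [al], hence at most [delta]. The factors 16 leave room for the comparison of
   the two ends [a] and [b]. *)
pose al := Num.min (delta / 16) (1 / 16).
have al0 : 0 < al by rewrite lt_min !divr_gt0.
have al1 : al <= 1 / 16 by rewrite ge_min lexx orbT.
have ald : 16 * al <= delta.
  have : al <= delta / 16 by rewrite ge_min lexx.
  lra.
have al3 : al ^+ 3 <= al.
  by rewrite exprS ger_pMr// exprn_ile1 ?(ltW al0)//; lra.
exists (al ^+ 3); split.
  by rewrite exprn_gt0//=; lra.
move=> y0 s hc; have L0 := theta_chain_gt0 hc.
case: hc => _; set yn := last y0 s in L0 *; set L := mdist y0 yn in L0 * => hs.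
have alL0 : 0 < al * L by rewrite mulr_gt0.
have alL1 : al * L <= 1 / 16 * L by rewrite ler_pM2r.
have alL3 : al ^+ 3 * L <= al * L by rewrite ler_pM2r.
pose P y := mdist y y0 <= al * L; pose Q y := mdist y yn <= al * L.
have hP : has P (y0 :: s) by rewrite /= /P mdistxx ltW.
have nPl : ~~ P yn by rewrite /P metric_sym -/L -ltNge; lra.
have [z [a [s2 [Pz za es2 aP lP]]]] := path_last_exit hP nPl hs.
have tri y : L <= mdist y y0 + mdist y yn.
  by rewrite (metric_sym y y0); exact: metric_triangle.
have a0 : mdist a y0 <= 2 * (al * L).
  have : mdist a y0 <= mdist a z + mdist z y0 := metric_triangle _ _ _.
  rewrite (metric_sym a z); move: Pz; rewrite /P; lra.
have an : 7 / 8 * L <= mdist a yn by have := tri a; lra.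
have nQa : ~~ Q a by rewrite /Q -ltNge; lra.
have Ql : Q (last a s2) by rewrite lP /Q mdistxx ltW.
have [t [c [t' [tE aQ Qc]]]] := seq_first_hit nQa Ql.
move: es2 aP; rewrite tE cat_path -cat_cons all_cat => /and3P[et ec _] /andP[aP _].
set b := last a t in ec.
have bn : mdist b yn <= 2 * (al * L).
  have : mdist b yn <= mdist b c + mdist c yn := metric_triangle _ _ _.
  move: Qc; rewrite /Q; lra.
have b0 : 7 / 8 * L <= mdist b y0 by have := tri b; lra.
have y0n : y0 != yn by rewrite -mdist_gt0.
have far y : ~~ P y -> y != y0.
  by apply: contraNneq => ->; rewrite /P mdistxx ltW.
have farn y : ~~ Q y -> y != yn.
  by apply: contraNneq => ->; rewrite /Q mdistxx ltW.
have aPQ : all [pred y | ~~ P y && ~~ Q y] (a :: t).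
  by apply/allP => y yt; apply/andP; split; [exact: (allP aP)|exact: (allP aQ)].
have bPQ : ~~ P b && ~~ Q b by exact: (allP aPQ _ (mem_last a t)).
have aPQ0 : ~~ P a && ~~ Q a by case/andP: aPQ.
have [/far by0 /farn byn] := andP bPQ; have [/far ay0 /farn ayn] := andP aPQ0.
have ab : a != b.
  apply/eqP => abE; move: b0; rewrite -abE; lra.
have close : path (mobius_close (g y0) (g yn) eta) (g a) (map g t).
  apply: (homo_path_in _ aPQ et) => x y; rewrite !inE => /andP[Px Qx] /andP[Py Qy] xy.
  (* A chain may repeat a point, whereas [hg] needs four distinct ones. *)
  have [->|nxy] := eqVneq x y.
    by rewrite /mobius_close mdistxx mul0r !mulr_ge0// ?mdist_ge0// ltW.
  have small u v : al * L < u -> al * L < v -> mdist x y * L <= delta * (u * v).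
    move=> hu hv; have uv : (al * L) * (al * L) <= u * v.
      by apply: ler_pM; rewrite // ltW.
    have h1 : mdist x y * L <= al ^+ 3 * L * L by rewrite ler_pM2r.
    have h2 : al * ((al * L) * (al * L)) <= al * (u * v) by rewrite ler_pM2l.
    have h3 : al * (u * v) <= delta * (u * v).
      apply: ler_wpM2r; last lra.
      by rewrite mulr_ge0// ltW// (lt_trans alL0).
    apply: le_trans h3; apply: le_trans h2; apply: le_trans h1 _.
    by rewrite le_eqVlt; apply/orP; left; apply/eqP; ring.
  have uniq4 u v : u \notin [:: x; y] -> v \notin [:: x; y] -> u != v ->
      uniq [:: x; u; y; v].
    rewrite /= !inE !negb_or (eq_sym x u) (eq_sym x v) (eq_sym y v) nxy.
    by move=> /andP[-> ->] /andP[-> ->] ->.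
  have x0 : y0 \notin [:: x; y].
    by rewrite !inE !negb_or !(eq_sym y0) !far.
  have xn : yn \notin [:: x; y].
    by rewrite !inE !negb_or !(eq_sym yn) !farn.
  move: Px Qx Py Qy; rewrite /P /Q -!ltNge => Px Qx Py Qy.
  have weaken u v w : 0 <= u -> 0 <= v ->
      w <= eta ^+ 2 / 4 * (u * v) -> w <= eta * (u * v).
    by move=> u0 v0 /le_trans; apply; rewrite ler_wpM2r// mulr_ge0.
  apply/andP; split; apply: weaken; rewrite ?mdist_ge0//.
    rewrite (metric_sym (g y0)) (metric_sym (g y)).
    apply: hg; first by rewrite uniq4// eq_sym.
    by rewrite (metric_sym yn y0) (metric_sym yn y); exact: small.
  rewrite (metric_sym (g y) (g y0)); apply: hg; first exact: uniq4.
  by rewrite (metric_sym y0 y); exact: small.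
(* Here [a] is within [2 * (al * L)] of [y0] and [b] of [yn], while both opposite distances are at
   least [7 / 8 * L]. *)
have hab : mdist (g a) (g y0) * mdist (g b) (g yn) <=
    eta ^+ 2 / 4 * (mdist (g b) (g y0) * mdist (g a) (g yn)).
  rewrite (mulrC (mdist (g b) (g y0))); apply: hg.
    by rewrite /= !inE !negb_or ab ay0 ayn by0 byn y0n.
  have h1 : mdist a y0 * mdist b yn <= (2 * (al * L)) * (2 * (al * L)).
    by apply: ler_pM; rewrite ?mdist_ge0.
  have h2 : (7 / 8 * L) * (7 / 8 * L) <= mdist a yn * mdist b y0.
    have L7 : 0 <= 7 / 8 * L by lra.
    exact: ler_pM.
  have h3 : al * (al * (L * L)) <= 1 / 16 * (al * (L * L)).
    by rewrite ler_pM2r// !mulr_gt0.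
  have h4 : 16 * al * (L * L) <= delta * (L * L) by rewrite ler_pM2r ?mulr_gt0.
  have := ler_wpM2l (ltW d0) h2.
  have : 0 < al * (L * L) by rewrite !mulr_gt0.
  lra.
rewrite -(inj_eq gI) in y0n.
have [||||||p0 [s' hs']] := @theta_chain_of_mobius_chain _ _ eta (g y0) (g yn)
  (g a) (map g t) e0 e1 y0n; rewrite ?last_map ?inj_eq//.
apply: (nochain p0 s'); suff <- : 12 * eta = theta by [].
by rewrite /eta mulrC divfK.
Qed.
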